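(* There is a universal constant $c_{\mathrm{prox}}>0$ such that the following holds. Fix $n\ge2$, $K\ge1$, $\mu>0$ and $\lambda\in(0,\mu]$. There is a two-dimensional composite finite sum, i.e. functions $f_1,\dots,f_n:\mathbb{R}^2\to\mathbb{R}$ and a proper, closed, convex $\psi:\mathbb{R}^2\to\mathbb{R}\cup\{+\infty\}$, together with an initial point $y_0$, such that each $f_i$ has $L$-Lipschitz gradient with $L=\mu$, $F=\frac1n\sum_{i=1}^n f_i$ is $\mu$-strongly convex with constant Hessian, the centered component variance is zero (i.e. $\frac1n\sum_{i=1}^n\|\nabla f_i(x)-\nabla F(x)\|^2=0$ for all $x$), and $\beta_\star=\|\nabla F(x^\dagger)\|=\lambda$, where $x^\dagger$ is the unique minimizer of $\mathcal P=F+\psi$; and such that, for every constant component stepsize $\eta$ satisfying $0<\mu\eta\le\frac12$, the ProxRR iterate $y_K$ obeys $$ \|y_K-x^\dagger\|^2\ge c_{\mathrm{prox}}\frac{\lambda^2}{\mu^2K^2}. $$ On the same instance, $$ \mathcal P(y_K)-\mathcal P(x^\dagger)=\frac\mu2\|y_K-x^\dagger\|^2 . $$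
   Context: ProxRR (one proximal step per epoch) with constant component stepsize $\eta>0$ and $h=n\eta$ starts from $y_0$. At each epoch $k=0,1,\dots$ it draws a fresh, independent, uniformly random permutation $\pi_k$ of $\{1,\dots,n\}$, sets $x_{k,0}=y_k$, performs $x_{k,i}=x_{k,i-1}-\eta\nabla f_{\pi_k(i)}(x_{k,i-1})$ for $i=1,\dots,n$, and sets $y_{k+1}=\operatorname{prox}_{h\psi}(x_{k,n})$, where $\operatorname{prox}_{\tau\psi}(z):=\operatorname{argmin}_u\{\tau\psi(u)+\frac12\|u-z\|^2\}$. When all component gradients coincide, the iterates are deterministic. *)

(* Defs.v *)
(* MathComp-Analysis development, over an arbitrary [R : realType]. *)
From HB Require Import structures.
From mathcomp Require Import all_boot all_order all_algebra all_fingroup.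
From mathcomp Require Import all_classical all_reals all_analysis.

Set Implicit Arguments.
Unset Strict Implicit.
Unset Printing Implicit Defensive.

Import Order.TTheory GRing.Theory Num.Theory.
Import numFieldNormedType.Exports.

Local Open Scope classical_set_scope.
Local Open Scope ring_scope.

(* The library norm on ['rV[R]_d] is the sup norm; the Euclidean norm is meant
   here.  (Differentiability and semicontinuity do not depend on this.) *)
Definition enorm (R : realType) (d : nat) (x : 'rV[R]_d) : R :=
  Num.sqrt (\sum_(j < d) x ord0 j ^+ 2).

(* Meaningful for differentiable [f], which is always assumed alongside. *)
Definition gradient (R : realType) (d : nat) (f : 'rV[R]_d -> R)
    (x : 'rV[R]_d) : 'rV[R]_d :=
  \row_(j < d) 'D_(delta_mx ord0 j) f x.

Definition lipschitz_gradient (R : realType) (d : nat) (L : R)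
    (f : 'rV[R]_d -> R) : Prop :=
  (forall x, differentiable f x) /\
  (forall x y, enorm (gradient f x - gradient f y) <= L * enorm (x - y)).

Definition strongly_convex (R : realType) (d : nat) (mu : R)
    (f : 'rV[R]_d -> R) : Prop :=
  forall (x y : 'rV[R]_d) (t : R), 0 <= t <= 1 ->
    f (t *: x + (1 - t) *: y) <=
    t * f x + (1 - t) * f y - mu / 2 * t * (1 - t) * enorm (x - y) ^+ 2.

Definition constant_hessian (R : realType) (d : nat)
    (f : 'rV[R]_d -> R) : Prop :=
  [/\ forall x, differentiable f x,
      forall x, differentiable (gradient f) x
    & exists H : 'M[R]_d, forall x, jacobian (gradient f) x = H].

Definition eproper (R : realType) (d : nat) (psi : 'rV[R]_d -> \bar R) : Prop :=
  (forall x, psi x != -oo%E) /\ (exists x, psi x != +oo%E).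

(* Closedness (of the epigraph) is [lower_semicontinuous].  The library has
   [0 * +oo = 0], so the endpoints [t = 0] and [t = 1] are harmless. *)
Definition econvex (R : realType) (d : nat) (psi : 'rV[R]_d -> \bar R) : Prop :=
  forall (x y : 'rV[R]_d) (t : R), 0 <= t <= 1 ->
    (psi (t *: x + (1 - t) *: y)%R <= t%:E * psi x + (1 - t)%:E * psi y)%E.

Definition is_minimizer (R : realType) (T : Type) (g : T -> \bar R) (x : T)
    : Prop :=
  forall y, (g x <= g y)%E.

Definition unique_minimizer (R : realType) (T : Type) (g : T -> \bar R) (x : T)
    : Prop :=
  is_minimizer g x /\ (forall y, is_minimizer g y -> y = x).

(* For [tau > 0] and proper closed convex [psi] the set of minimizers is a
   singleton, so the default value [0] of [xget] is never used. *)
Definition prox (R : realType) (d : nat) (tau : R) (psi : 'rV[R]_d -> \bar R)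
    (z : 'rV[R]_d) : 'rV[R]_d :=
  xget 0 [set u | is_minimizer
    (fun v => tau%:E * psi v + (2^-1 * enorm (v - z) ^+ 2)%:E)%E u].

Definition average (R : realType) (d n : nat) (f : 'I_n -> 'rV[R]_d -> R)
    (x : 'rV[R]_d) : R :=
  n%:R^-1 * \sum_(i < n) f i x.

Definition composite (R : realType) (d : nat) (F : 'rV[R]_d -> R)
    (psi : 'rV[R]_d -> \bar R) (x : 'rV[R]_d) : \bar R :=
  ((F x)%:E + psi x)%E.

Definition component_variance (R : realType) (d n : nat)
    (f : 'I_n -> 'rV[R]_d -> R) (x : 'rV[R]_d) : R :=
  n%:R^-1 *
  \sum_(i < n) enorm (gradient (f i) x - gradient (average f) x) ^+ 2.

Definition rr_epoch (R : realType) (d n : nat) (f : 'I_n -> 'rV[R]_d -> R)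
    (eta : R) (p : 'S_n) (y : 'rV[R]_d) : 'rV[R]_d :=
  foldl (fun x i => x - eta *: gradient (f (p i)) x) y (enum 'I_n).

Fixpoint proxrr (R : realType) (d n : nat) (f : 'I_n -> 'rV[R]_d -> R)
    (psi : 'rV[R]_d -> \bar R) (eta : R) (y0 : 'rV[R]_d) (p : nat -> 'S_n)
    (k : nat) : 'rV[R]_d :=
  if k is k'.+1 then
    prox (n%:R * eta) psi
      (rr_epoch f eta (p k') (proxrr f psi eta y0 p k'))
  else y0.

(* [pi] is an i.i.d. sequence of uniformly distributed random permutations. *)
Definition random_reshuffling (R : realType) (dO : measure_display)
    (Omega : measurableType dO) (P : probability Omega R) (n : nat)
    (pi : nat -> Omega -> 'S_n) : Prop :=
  [/\ forall k (A : set 'S_n), measurable (pi k @^-1` A),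
      forall k (s : 'S_n), P (pi k @^-1` [set s]) = (n`!%:R^-1)%:E
    & forall (J : seq nat) (A : nat -> set 'S_n), uniq J ->
        P (\bigcap_(k in [set` J]) (pi k @^-1` A k)) =
        (\prod_(k <- J) P (pi k @^-1` A k))%E].

(* Main.v *)
(* All components equal [F x = mu/2 |x|^2 + <b, x>] with [|b| = lambda], and
   [psi x = - <b, x>], so the composite objective is [mu/2 |x|^2], minimized
   at [0]. Starting from [b / mu] the iterates stay on the line of [b]. With
   [q = (1 - mu eta)^n] and [s = n mu eta], the coefficient in units of
   [b / mu] obeys [c' = q c + (s - (1 - q))]: small steps do not contract the
   initial error, while for larger ones the mismatch between [n] gradient steps
   and one long proximal step leaves a bias of order [s]. Bernoulli's inequality
   separates the two regimes at [s] of order [1 / K]. *)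
Require Import Defs.
From HB Require Import structures.
From mathcomp Require Import all_boot all_order all_algebra all_fingroup.
From mathcomp Require Import all_classical all_reals all_analysis.
From mathcomp Require Import ring lra.

Set Implicit Arguments.
Unset Strict Implicit.
Unset Printing Implicit Defensive.

Import Order.TTheory GRing.Theory Num.Theory.
Import numFieldNormedType.Exports.

Local Open Scope classical_set_scope.
Local Open Scope ring_scope.

(** * Inner product and squared Euclidean norm *)

Definition dot (R : realType) (d : nat) (x y : 'rV[R]_d) : R :=
  \sum_(j < d) x ord0 j * y ord0 j.

Definition quad (R : realType) (d : nat) (mu : R) (b x : 'rV[R]_d) : R :=
  mu / 2 * dot x x + dot b x.

Lemma foldl_const (T S : Type) (g : T -> T) (s : seq S) y :
  foldl (fun x _ => g x) y s = iter (size s) g y.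
Proof. by elim: s y => //= a s IH y; rewrite IH -iterSr. Qed.

Section Euclidean.
Variables (R : realType) (d : nat).
Implicit Types (x y z b v : 'rV[R]_d) (t mu : R).

Lemma dotC x y : dot x y = dot y x.
Proof. by apply: eq_bigr => j _; rewrite mulrC. Qed.

Lemma dotDr x y z : dot x (y + z) = dot x y + dot x z.
Proof. by rewrite -big_split; apply: eq_bigr => j _; rewrite mxE mulrDr. Qed.

Lemma dotZr t x y : dot x (t *: y) = t * dot x y.
Proof. by rewrite mulr_sumr; apply: eq_bigr => j _; rewrite mxE mulrCA. Qed.

Lemma dotDl x y z : dot (x + y) z = dot x z + dot y z.
Proof. by rewrite dotC dotDr !(dotC z). Qed.

Lemma dotZl t x y : dot (t *: x) y = t * dot x y.
Proof. by rewrite dotC dotZr dotC. Qed.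

Lemma dotNl x y : dot (- x) y = - dot x y.
Proof. by rewrite -scaleN1r dotZl mulN1r. Qed.

Lemma dotNr x y : dot x (- y) = - dot x y.
Proof. by rewrite dotC dotNl dotC. Qed.

Definition dotE := (dotDl, dotDr, dotNl, dotNr, dotZl, dotZr).

Lemma dotxx_ge0 x : 0 <= dot x x.
Proof. by apply: sumr_ge0 => j _; rewrite -expr2 sqr_ge0. Qed.

Lemma dotxx_eq0 x : dot x x = 0 -> x = 0.
Proof.
move=> /psumr_eq0P x0; apply/rowP => j; rewrite mxE; apply/eqP.
by rewrite -sqrf_eq0 expr2 x0 // => i _; rewrite -expr2 sqr_ge0.
Qed.

Lemma enorm_sqr x : enorm x ^+ 2 = dot x x.
Proof.
by rewrite sqr_sqrtr; [|apply: sumr_ge0 => j _; rewrite sqr_ge0].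
Qed.

Lemma enorm_ge0 x : 0 <= enorm x.
Proof. exact: sqrtr_ge0. Qed.

Lemma enormZ t x : enorm (t *: x) = `|t| * enorm x.
Proof.
apply/eqP; rewrite -(@eqrXn2 _ 2) ?enorm_ge0 ?mulr_ge0 ?enorm_ge0 //.
by rewrite exprMn !enorm_sqr real_normK ?num_real // dotZl dotZr mulrA expr2.
Qed.

Lemma enorm0 : enorm (0 : 'rV[R]_d) = 0.
Proof. by rewrite -(scale0r (0 : 'rV[R]_d)) enormZ normr0 mul0r. Qed.

(** * Differential calculus of the quadratic *)

Lemma is_diff_coord j x : is_diff x (fun y => y ord0 j) (fun y => y ord0 j).
Proof.
have lin : linear (fun y : 'rV[R]_d => y ord0 j) by move=> k u v; rewrite !mxE.
pose f : {linear 'rV[R]_d -> R} := HB.pack (fun y : 'rV[R]_d => y ord0 j)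
  (GRing.isLinear.Build _ _ _ _ _ lin).
have cf : continuous f by exact: coord_continuous.
apply: DiffDef; last exact: (diff_lin x cf).
exact: differentiable_coord.
Qed.

Lemma is_derive_coord j x v :
  is_derive x v (fun y : 'rV[R]_d => y ord0 j) (v ord0 j).
Proof.
have := is_diff_coord j x => -[df dE].
by split; [exact: diff_derivable | rewrite deriveE // dE].
Qed.

(** Gives the form on which the differentiation rules for sums, powers and scalings act. *)
Lemma quadE mu b : quad mu b = \sum_(j < d)
  ((mu / 2) *: (fun y : 'rV[R]_d => y ord0 j) ^+ 2
   + b ord0 j *: (fun y : 'rV[R]_d => y ord0 j)).
Proof.
apply/funext => x; rewrite /quad /dot fct_sumE mulr_sumr -big_split.
by apply: eq_bigr => j _.
Qed.

Lemma quad_differentiable mu b x : differentiable (quad mu b) x.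
Proof.
rewrite quadE; apply: differentiable_sum => j.
have := is_diff_coord j x => dj.
by apply: differentiableD.
Qed.

Lemma quad_gradient mu b : gradient (quad mu b) = fun x => mu *: x + b.
Proof.
apply/funext => x; apply/rowP => j; rewrite !mxE quadE.
pose v : 'rV[R]_d := delta_mx ord0 j.
have h i := is_derive_coord i x v.
(* Along [v] every coordinate other than [j] has zero derivative, so one summand survives. *)
rewrite derive_val; rewrite (bigD1 j) //= big1 ?addr0 => [|i /negPf ij].
  by rewrite /v !mxE !eqxx /GRing.scale /=; field.
by rewrite /v !mxE ij /GRing.scale /= !mulr0n; ring.
Qed.

Lemma is_diff_affine mu b x : is_diff x (fun y => mu *: y + b) ( *:%R mu).
Proof.
have -> : (fun y => mu *: y + b) = ( *:%R mu) + cst b by apply/funext.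
by apply: is_diff_eq; rewrite addr0.
Qed.

Lemma quad_lipschitz_gradient mu b : 0 <= mu ->
  lipschitz_gradient mu (quad mu b).
Proof.
move=> mu0; split=> [x|x y]; first exact: quad_differentiable.
by rewrite quad_gradient opprD addrACA subrr addr0 -scalerBr enormZ ger0_norm.
Qed.

(** Equality holds: the linear part cancels, and |t x + (1-t) y|^2 = t |x|^2 + (1-t) |y|^2 - t (1-t)
    |x-y|^2. *)
Lemma quad_strongly_convex mu b : strongly_convex mu (quad mu b).
Proof.
move=> x y t _; rewrite le_eqVlt; apply/orP; left; apply/eqP.
by rewrite enorm_sqr /quad !dotE (dotC y x); ring.
Qed.

Lemma quad_constant_hessian mu b : constant_hessian (quad mu b).
Proof.
rewrite /constant_hessian quad_gradient; split=> [x|x|].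
- exact: quad_differentiable.
- by have [] := is_diff_affine mu b x.
- exists (lin1_mx ( *:%R mu)) => x.
  by rewrite /jacobian; have [_ ->] := is_diff_affine mu b x.
Qed.

(** * The linear regularizer and its proximal step *)

Definition elin b x : \bar R := (dot b x)%:E.

Lemma elin_proper b : eproper (elin b).
Proof. by split=> [//|]; exists 0. Qed.

Lemma dot_continuous b : continuous (dot b).
Proof.
have -> : dot b = quad 0 b by apply/funext => x; rewrite /quad !mul0r add0r.
by move=> x; apply: differentiable_continuous; exact: quad_differentiable.
Qed.

Lemma elin_lsc b : lower_semicontinuous (elin b).
Proof.
apply/lower_semicontinuousP => a.
have -> : [set x | (a%:E < elin b x)%E] = dot b @^-1` [set t | a < t].
  by apply/seteqP; split=> x /=; rewrite lte_fin.
apply: open_comp; last exact: open_gt.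
by move=> x _; exact: dot_continuous.
Qed.

Lemma elin_convex b : econvex (elin b).
Proof. by move=> x y t _; rewrite /elin -!EFinM -EFinD dotDr !dotZr. Qed.

Lemma prox_elin tau b z : prox tau (elin b) z = z - tau *: b.
Proof.
set g := (fun v => tau%:E * elin b v + (2^-1 * enorm (v - z) ^+ 2)%:E)%E.
(* Completing the square: up to a constant, the objective is half the squared distance to
   [z - tau *: b]. *)
have gE v : g v = (2^-1 * dot (v - (z - tau *: b)) (v - (z - tau *: b))
    + tau * dot b z - 2^-1 * tau ^+ 2 * dot b b)%:E.
  rewrite /g /elin -EFinM -EFinD enorm_sqr !dotE (dotC z v) (dotC v b).
  by rewrite (dotC z b); congr EFin; field.
have dot0 : dot (0 : 'rV[R]_d) 0 = 0 by rewrite -{1}(scale0r b) dotZl mul0r.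
have le_g v : (g (z - tau *: b)%R <= g v)%E.
  rewrite !gE subrr dot0 lee_fin.
  by have := dotxx_ge0 (v - (z - tau *: b)); lra.
(* Existence and uniqueness exclude the default of [xget]: any minimizer is at nonpositive squared
   distance from this point. *)
apply: xget_unique => [v|v /(_ (z - tau *: b))]; first exact: le_g.
rewrite -[X in (X <= _)%E]/(g _) -[X in (_ <= X)%E]/(g _) !gE.
rewrite subrr dot0 lee_fin => le_v.
apply/subr0_eq/dotxx_eq0; have := dotxx_ge0 (v - (z - tau *: b)); lra.
Qed.

Lemma average_const n (f : 'rV[R]_d -> R) : (0 < n)%N ->
  average (fun _ : 'I_n => f) = f.
Proof.
move=> n0; apply/funext => x; rewrite /average sumr_const.
rewrite card_ord -[_ *+ _ in X in _ * X]mulr_natl.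
by rewrite mulKf // pnatr_eq0 -lt0n.
Qed.

(** A gradient step fixes -b/mu and multiplies the displacement from it by 1 - mu eta; on the line
    of [b] that displacement is t + 1/mu. *)
Lemma rr_epoch_quad n mu b eta (p : 'S_n) t : mu != 0 ->
  rr_epoch (fun=> quad mu b) eta p (t *: b)
  = ((1 - mu * eta) ^+ n * (t + mu^-1) - mu^-1) *: b.
(* Equal components make the step blind to the index, so the shuffled pass is an [n]-fold iteration
   whatever [p] is. *)
Proof.
move=> mu0; rewrite /rr_epoch quad_gradient foldl_const size_enum_ord.
elim: n {p} => [|n IH] /=; first by rewrite mul1r addrK.
rewrite IH exprS scalerDr scalerA scalerA -scalerDl -scalerBl.
by congr (_ *: _); field.
Qed.

(** The linear terms cancel in the objective, but the gradient of the smooth part at the minimizer 0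
    is still [b]. *)
Lemma composite_quad_elin mu b x :
  composite (quad mu b) (elin (- b)) x = (mu / 2 * enorm x ^+ 2)%:E.
Proof.
rewrite /composite /elin /quad -EFinD dotNl enorm_sqr.
by congr EFin; ring.
Qed.

End Euclidean.

(** * The scalar recursion and its lower bound *)

Section Scalar.
Variable R : realType.
Implicit Types x t : R.

(* Equivalently [n x - (1 - q) >= (n x / 4) (1 - q)] for [q = (1 - x) ^+ n];
   at [n = 1] the left-hand side vanishes, as proximal gradient is unbiased. *)
Lemma epoch_bias n x : (2 <= n)%N -> 0 <= x <= 1 ->
  (1 + n%:R * x / 4) * (1 - (1 - x) ^+ n) <= n%:R * x.
Proof.
move=> n2 x01; elim: n n2 => // n IH; rewrite leq_eqVlt => /orP[/eqP<-|n2].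
  by rewrite !exprS expr0; nra.
have {}IH := IH n2.
have n2R : 2 <= n%:R :> R by rewrite ler_nat.
rewrite exprS -natr1; move: (_ ^+ n) (n%:R) IH n2R => q m IH m2.
(* Multiplying by this factor lets the induction hypothesis bound [1 - q], since
   [1 - (1 - x) * q = x + (1 - x) * (1 - q)]. *)
have c0 : 0 < 1 + m * x / 4 by nra.
rewrite -(ler_pM2l c0).
have : (1 - x) * (1 + (m + 1) * x / 4) * ((1 + m * x / 4) * (1 - q))
     <= (1 - x) * (1 + (m + 1) * x / 4) * (m * x).
  by apply: ler_wpM2l => //; apply: mulr_ge0; nra.
(* This is exactly the slack left once the induction hypothesis is substituted; it is nonnegative
   because [2 <= m] and [0 <= x]. *)
have : 0 <= x ^+ 2 * ((3 * m - (m + 1)) / 4 + 3 / 16 * m * (m + 1) * x).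
  by apply: mulr_ge0; [exact: sqr_ge0 | nra].
nra.
Qed.

Fixpoint epoch_coef n x (k : nat) : R :=
  if k is k'.+1
  then (1 - x) ^+ n * (epoch_coef n x k' + 1) - 1 + n%:R * x else 1.

(** Let q = (1-x)^n and s = n x. By [epoch_bias] the new coefficient is at least q times the old one
    plus (1-q) s/4; from the start value 1 this unrolls to a convex combination of 1 and s/4. *)
Lemma epoch_coef_ge n x k : (2 <= n)%N -> 0 <= x <= 1 ->
  (1 - x) ^+ (n * k) + (1 - (1 - x) ^+ (n * k)) * (n%:R * x / 4)
  <= epoch_coef n x k.
Proof.
move=> n2 x01; elim: k => [|k IH] /=.
  by rewrite muln0 expr0 subrr mul0r addr0.
have B := epoch_bias n2 x01.
have q0 : 0 <= (1 - x) ^+ n by apply: exprn_ge0; lra.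
rewrite mulnS exprD; have := ler_wpM2l q0 IH; nra.
Qed.

Lemma epoch_coef_lower n x K : (2 <= n)%N -> (1 <= K)%N -> 0 <= x <= 1 ->
  (8 * K%:R)^-1 <= epoch_coef n x K.
Proof.
move=> n2 K1 x01; apply: le_trans (epoch_coef_ge K n2 x01).
have K1R : 1 <= K%:R :> R by rewrite ler1n.
have q1 : (1 - x) ^+ (n * K) <= 1 by apply: exprn_ile1; lra.
have q0 : 0 <= (1 - x) ^+ (n * K) by apply: exprn_ge0; lra.
have bern : 1 - (n%:R * x) * K%:R <= (1 - x) ^+ (n * K).
  have : 1 - (n * K)%:R * x <= (1 - x) ^+ (n * K).
    elim: (n * K)%N => [|m IH]; first by rewrite expr0; lra.
    rewrite exprS -natr1; have m0 : 0 <= m%:R :> R by [].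
    by have := @ler_wpM2l _ (1 - x) ltac:(lra) _ _ IH; nra.
  by rewrite natrM; lra.
have s0 : 0 <= n%:R * x by apply: mulr_ge0 => //; lra.
move: (_ ^+ _) (n%:R * x) K%:R K1R q0 q1 bern s0 => q s k k1 q0 q1 bern s0.
have k0 : 0 < 8 * k by lra.
rewrite -(ler_pM2l k0) divff ?gt_eqF //.
(* If [2 * (s * k) <= 1], Bernoulli keeps at least half of the initial error. Otherwise [s / 4]
   exceeds 1/(8k), and so does 1, hence also their convex combination; this fixes the constant 8. *)
have [sk|sk] := lerP (2 * (s * k)) 1.
  have : 0 <= (1 - q) * (s / 4) by apply: mulr_ge0; lra.
  by nra.
have : 1 / 2 * (1 - q) <= s * k * (1 - q) by apply: ler_wpM2r; lra.
nra.
Qed.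

End Scalar.

(** * The iterates of the instance and the final bound *)

Lemma proxrr_quad (R : realType) (d n : nat) (mu eta : R) (b : 'rV[R]_d)
    (p : nat -> 'S_n) (k : nat) : mu != 0 ->
  proxrr (fun=> quad mu b) (elin (- b)) eta (mu^-1 *: b) p k
  = (epoch_coef n (mu * eta) k / mu) *: b.
Proof.
move=> mu0; elim: k => [|k IH] /=; first by rewrite mul1r.
(* The epoch sends c/mu to (q (c+1) - 1)/mu, and the proximal step with slope [- b] adds n eta = n
   (mu eta)/mu. *)
rewrite IH rr_epoch_quad // prox_elin scalerN opprK -scalerDl.
by congr (_ *: _); field.
Qed.

Theorem theorem6p8 (R : realType) :
  exists cprox : R, 0 < cprox /\
  forall (n K : nat) (mu lambda : R),
    (2 <= n)%N -> (1 <= K)%N -> 0 < mu -> 0 < lambda <= mu ->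
  exists (f : 'I_n -> 'rV[R]_2 -> R) (psi : 'rV[R]_2 -> \bar R)
         (y0 xdag : 'rV[R]_2),
    (eproper psi /\ lower_semicontinuous psi /\ econvex psi) /\
    (forall i, lipschitz_gradient mu (f i)) /\
    strongly_convex mu (average f) /\
    constant_hessian (average f) /\
    (forall x, component_variance f x = 0) /\
    unique_minimizer (composite (average f) psi) xdag /\
    enorm (gradient (average f) xdag) = lambda /\
    forall eta : R, 0 < mu * eta <= 2^-1 ->
    forall (dO : measure_display) (Omega : measurableType dO)
           (P : probability Omega R) (pi : nat -> Omega -> 'S_n),
      random_reshuffling P pi ->
    forall w : Omega,
      let yK := proxrr f psi eta y0 (fun k => pi k w) K in
      enorm (yK - xdag) ^+ 2 >= cprox * (lambda ^+ 2 / (mu ^+ 2 * K%:R ^+ 2)) /\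
      (composite (average f) psi yK - composite (average f) psi xdag)%E =
      (mu / 2 * enorm (yK - xdag) ^+ 2)%:E.
Proof.
(* The square of the 1/8 in [epoch_coef_lower]. *)
exists (64^-1); split; first by lra.
move=> n K mu lambda n2 K1 mu0 /andP[l0 _].
pose b : 'rV[R]_2 := lambda *: delta_mx ord0 ord0.
have bE : enorm b = lambda.
  rewrite enormZ gtr0_norm // /enorm big_ord_recl big_ord1 !mxE /=.
  by rewrite expr1n expr0n addr0 sqrtr1 mulr1.
exists (fun=> quad mu b), (elin (- b)), (mu^-1 *: b), 0.
rewrite average_const ?(ltn_trans _ n2) //.
split; first by split; [exact: elin_proper|split;
  [exact: elin_lsc | exact: elin_convex]].
split; first by move=> _; apply: quad_lipschitz_gradient; exact: ltW.
split; first exact: quad_strongly_convex.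
split; first exact: quad_constant_hessian.
split.
  move=> x; rewrite /component_variance average_const ?(ltn_trans _ n2) //.
  by rewrite subrr enorm0 expr0n /= big1 // mulr0.
split.
  split=> y.
    rewrite !composite_quad_elin enorm0 lee_fin expr0n mulr0.
    by rewrite mulr_ge0 ?sqr_ge0 // divr_ge0 // ltW.
  move=> /(_ 0); rewrite !composite_quad_elin enorm0 expr0n mulr0 lee_fin.
  rewrite enorm_sqr pmulr_rle0 ?divr_gt0 // => y0.
  by apply: dotxx_eq0; apply/eqP; rewrite eq_le y0 dotxx_ge0.
split; first by rewrite quad_gradient scaler0 add0r.
move=> eta eta01 dO Omega P pi _ w yK; rewrite subr0; split; last first.
  by rewrite !composite_quad_elin enorm0 expr0n mulr0 sube0.
(* The closed form holds for every sequence of permutations, so the bound holds at each outcome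
   [w]. *)
rewrite /yK proxrr_quad ?gt_eqF // enormZ bE exprMn real_normK ?num_real //.
have C : (8 * K%:R)^-1 <= epoch_coef n (mu * eta) K.
  by apply: epoch_coef_lower => //; lra.
have K0 : 0 < K%:R :> R by rewrite ltr0n.
rewrite expr_div_n.
have -> : 64^-1 * (lambda ^+ 2 / (mu ^+ 2 * K%:R ^+ 2))
  = ((8 * K%:R)^-1) ^+ 2 / mu ^+ 2 * lambda ^+ 2.
  by field; rewrite !gt_eqF.
rewrite ler_wpM2r ?sqr_ge0 // ler_wpM2r ?invr_ge0 ?sqr_ge0 //.
have h0 : 0 <= (8 * K%:R)^-1 :> R by rewrite invr_ge0; lra.
by rewrite ler_pXn2r // nnegrE (le_trans h0).
Qed.
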